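(* For all integers $n \geq 0$, \[ P(n) \leq f(n) + Q(g(n)) \qquad\text{and}\qquad Q(n) \leq 1 + f(n) + P(g(n)). \]
   Context: For $A \subseteq \{0,1,2,\ldots\}$, $\partial A = \{z \in A : \{z-1,z+1\} \not\subseteq A\}$, $vol(A)=\sum_{z\in A} z$, $per(A) = \sum_{z \in \partial A} z$ (both $0$ for the empty set), and $A^c = \{0,1,2,\ldots\}\setminus A$. For integers $n\ge 0$, $P(n) = \min\{per(A) : A \subseteq \{0,1,\ldots\},\ vol(A)=n\}$ and $Q(n) = \min\{per(A^c) : A \subseteq \{0,1,\ldots\},\ vol(A) = n\}$. Also $f(n) = \lceil (-1+\sqrt{1+8n})/2 \rceil$ and $g(n) = f(n)(f(n)+1)/2 - n$. *)

(* Defs.v *)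
From mathcomp Require Import all_boot all_order all_algebra.
From mathcomp Require Import all_classical all_reals all_analysis.
From mathcomp Require Import finmap lra zify.

Set Implicit Arguments.
Unset Strict Implicit.
Unset Printing Implicit Defensive.

Import Order.TTheory GRing.Theory Num.Theory.

Local Open Scope classical_set_scope.
Local Open Scope ring_scope.

(* The neighbours z - 1 and z + 1 are taken in int, so that 0 (whose left
   neighbour is -1) lies on the boundary of every set containing it. *)
Definition boundary (A : set nat) : set nat :=
  [set z | A z /\ ~ ([set z%:Z - 1; z%:Z + 1] `<=` Posz @` A)].

(* Sums are taken in \bar R, so an infinite set has volume +oo.  The real field
   R only serves to host these sums and the square root in f. *)
Definition vol (R : realType) (A : set nat) : \bar R :=
  (\esum_(z in A) z%:R%:E)%E.

Definition per (R : realType) (A : set nat) : \bar R := vol R (boundary A).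

Lemma finite_vol (R : realType) (A : set nat) :
  finite_set A -> exists k : nat, vol R A = k%:R%:E.
Proof.
move=> finA; rewrite /vol esum_fset//.
rewrite fsbig_finite//=; exists (\sum_(z <- enum_fset (fset_set A)) z)%N.
by rewrite sumEFin natr_sum.
Qed.

Lemma boundary_setC_finite (A : set nat) :
  finite_set A -> finite_set (boundary (~` A)).
Proof.
move=> finA.
apply: (@sub_finite_set _ _ ([set 0%N] `|` (S @` A `|` predn @` A))); last first.
  by rewrite !finite_setU; split=> //; split; exact: finite_image.
move=> z [nAz nsub].
have [->|z0] := eqVneq z 0%N; first by left.
right; apply: contrapT => /not_orP[h1 h2]; apply: nsub => x [->|->].
  exists z.-1; last by lia.
  by move=> Az; apply: h1; exists z.-1 => //; rewrite prednK// lt0n.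
exists z.+1; last by lia.
by move=> Az; apply: h2; exists z.+1.
Qed.

Lemma P_attained (R : realType) (n : nat) :
  exists k : nat,
    `[< exists A : set nat, vol R A = n%:R%:E /\ per R A = k%:R%:E >].
Proof.
have [|k hk] := @finite_vol R (boundary [set n]).
  by apply: (@sub_finite_set _ _ [set n]) => // z [].
exists k; apply/asboolP; exists [set n]; split => //.
by rewrite /vol esum_set1// lee_fin.
Qed.

Lemma Q_attained (R : realType) (n : nat) :
  exists k : nat,
    `[< exists A : set nat, vol R A = n%:R%:E /\ per R (~` A) = k%:R%:E >].
Proof.
have [|k hk] := @finite_vol R (boundary (~` [set n])).
  exact: boundary_setC_finite.
exists k; apply/asboolP; exists [set n]; split => //.
by rewrite /vol esum_set1// lee_fin.
Qed.

(* The minima may be taken over nat: a set of finite volume is finite, hence by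
   finite_vol both it and its complement have natural-number perimeters. *)
Definition P (R : realType) (n : nat) : nat := ex_minn (P_attained R n).

Definition Q (R : realType) (n : nat) : nat := ex_minn (Q_attained R n).

(* Neither the absolute value in f nor the truncated division and subtraction
   in g lose anything: see fE and gE. *)
Definition f (R : realType) (n : nat) : nat :=
  `|Num.ceil ((-1 + Num.sqrt (1 + 8 * n%:R)) / 2 : R)|%N.

Definition g (R : realType) (n : nat) : nat :=
  ((f R n * (f R n).+1) %/ 2 - n)%N.

Lemma fE (R : realType) (n : nat) :
  (f R n)%:Z = Num.ceil ((-1 + Num.sqrt (1 + 8 * n%:R)) / 2 : R).
Proof.
rewrite /f gez0_abs// ceil_ge0.
have := sqrtr_ge0 (1 + 8 * n%:R : R); lra.
Qed.

Lemma gE (R : realType) (n : nat) :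
  (g R n)%:R = (f R n)%:R * ((f R n)%:R + 1) / 2 - n%:R :> R.
Proof.
have even2 : (2 %| f R n * (f R n).+1)%N by rewrite dvdn2 oddM /=; case: odd.
have half : ((f R n * (f R n).+1) %/ 2)%:R
    = (f R n)%:R * ((f R n)%:R + 1) / 2 :> R.
  have /(congr1 (fun m : nat => m%:R : R)) := divnK even2.
  by rewrite !natrM -(natr1 (f R n)); lra.
rewrite /g natrB ?half// -(ler_nat R) half.
have := ceil_ge ((-1 + Num.sqrt (1 + 8 * n%:R)) / 2 : R).
rewrite -fE -pmulrn.
have s0 := sqrtr_ge0 (1 + 8 * n%:R : R).
have n0 : 0 <= n%:R :> R by [].
have : Num.sqrt (1 + 8 * n%:R : R) ^+ 2 = 1 + 8 * n%:R.
  by rewrite sqr_sqrtr//; lra.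
set s := Num.sqrt _ in s0 *; set m : R := (f R n)%:R => s2 sm.
have sm' : s <= 2 * m + 1 by lra.
have : s ^+ 2 <= (2 * m + 1) ^+ 2.
  by rewrite lerXn2r// nnegrE; lra.
rewrite s2 expr2; lra.
Qed.

(* Main.v *)
Require Import Defs.
From mathcomp Require Import all_boot all_order all_algebra.
From mathcomp Require Import all_classical all_reals all_analysis.
From mathcomp Require Import lra zify.

(** Let [m = f n] and let [B] be optimal for [g n].  Since [g n <= m], [B] lies in
    [{0, .., m}], and [A = {0, .., m} \ B] has volume [m (m + 1) / 2 - g n = n].
    Removing [B] from the interval exchanges the roles of a set and its complement:
    the only boundary point of [A] outside the boundary of [~` B] is [m], and the
    only boundary point of [~` A] outside the boundary of [B] is [m + 1]. *)

Set Implicit Arguments.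
Unset Strict Implicit.
Unset Printing Implicit Defensive.

Import Order.TTheory GRing.Theory Num.Theory.

Local Open Scope classical_set_scope.
Local Open Scope ring_scope.

(** Trades [int] neighbours for [nat] ones. The conjunct [0 < z] is essential: [0.-1] is [0], so
    without it [0] could pass for an interior point. *)
Lemma boundaryE (A : set nat) (z : nat) :
  boundary A z <-> A z /\ ~ [/\ (0 < z)%N, A z.-1 & A z.+1].
Proof.
suff E : [set z%:Z - 1; z%:Z + 1] `<=` Posz @` A <->
    [/\ (0 < z)%N, A z.-1 & A z.+1].
  by rewrite /boundary /= E.
split=> [sub|[z0 Ap As] _ [->|->]]; last 2 first.
- by exists z.-1 => //; lia.
- by exists z.+1 => //; lia.
have [y Ay yE] := sub (z%:Z - 1) (or_introl erefl).
have [x Ax xE] := sub (z%:Z + 1) (or_intror erefl).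
have -> : z.-1 = y by lia.
have -> : z.+1 = x by lia.
by split=> //; lia.
Qed.

Lemma boundary_II_setD (m : nat) (B : set nat) :
  boundary (`I_m.+1 `\` B) `<=` m |` boundary (~` B).
Proof.
move=> z /boundaryE[[/= zm Bz] nint].
have [->|zNm] := eqVneq z m; [by left|right].
apply/boundaryE; split=> // -[z0 Bp Bs]; apply: nint.
by split=> //; split=> //=; lia.
Qed.

Lemma boundary_setC_II_setD (m : nat) (B : set nat) :
  boundary (~` (`I_m.+1 `\` B)) `<=` m.+1 |` boundary B.
Proof.
move=> z /boundaryE[Cz nint].
have [->|zNm] := eqVneq z m.+1; [by left|right].
have subC x : B x \/ (m < x)%N -> (~` (`I_m.+1 `\` B)) x.
  by move=> [Bx [_]//|mx [/= xm _]]; lia.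
(* Past [m.+1], even the left neighbour exceeds [m], so the point is interior to the complement. *)
have zm : (z <= m)%N.
  rewrite leqNgt; apply/negP => mz; apply: nint.
  by split; [lia|apply: subC; right; lia|apply: subC; right; lia].
apply/boundaryE; split; first by apply: contrapT => Bz; apply: Cz.
by move=> [z0 Bp Bs]; apply: nint; split=> //; apply: subC; left.
Qed.

Section Volume.
Variable R : realType.
Implicit Types A B : set nat.
Local Open Scope ereal_scope.

Lemma vol_ge0 A : 0 <= vol R A.
Proof. by apply: esum_ge0 => z _; rewrite lee_fin. Qed.

Lemma vol_set1 (x : nat) : vol R [set x] = x%:R%:E.
Proof. by rewrite /vol esum_set1// lee_fin. Qed.

Lemma volID B A : vol R A = vol R (A `&` B) + vol R (A `\` B).
Proof. by rewrite /vol (esumID B)// => z _; rewrite lee_fin. Qed.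

Lemma vol_setD A B : B `<=` A -> vol R A = vol R B + vol R (A `\` B).
Proof. by move=> BA; rewrite (volID B) setIidr. Qed.

Lemma le_vol A B : B `<=` A -> vol R B <= vol R A.
Proof. by move=> BA; rewrite (vol_setD BA) leeDl// vol_ge0. Qed.

Lemma vol_setU1 (x : nat) A : vol R (x |` A) <= x%:R%:E + vol R A.
Proof.
rewrite (@vol_setD _ [set x]); last by move=> z ->; left.
by rewrite vol_set1 leeD2l// le_vol// => z [[->|//] /(_ erefl)].
Qed.

Lemma vol_II (k : nat) : vol R `I_k = 'C(k, 2)%:R%:E.
Proof.
elim: k => [|k IH]; first by rewrite II0 /vol esum_set0.
rewrite (@vol_setD _ [set k]); last by move=> z ->; exact: ltnSn.
rewrite vol_set1 (_ : _ `\` _ = `I_k).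
  by rewrite IH -EFinD -natrD binS bin1 addnC.
by apply/seteqP; split=> z /=; [move=> [? /eqP]|]; lia.
Qed.

(** All terms of the sum are nonnegative, so no single element exceeds the volume. *)
Lemma vol_subset_II A (k : nat) : vol R A <= k%:R%:E -> A `<=` `I_k.+1.
Proof.
move=> Ak z Az; have : [set z] `<=` A by move=> _ ->.
by move=> /le_vol /le_trans /(_ Ak); rewrite vol_set1 lee_fin ler_nat.
Qed.

End Volume.

Section TriangularRoot.
Variable R : realType.

Lemma g_addn (n : nat) : (g R n + n)%N = 'C((f R n).+1, 2).
Proof.
rewrite bin2 /=.
have : (g R n + n)%:R * 2 = (f R n * (f R n).+1)%:R :> R.
  by rewrite natrD natrM gE subrK divfK ?natr1.
by rewrite -natrM => /eqP; rewrite eqr_nat => /eqP; lia.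
Qed.

(** With [m = f n], the ceiling gives [2m - 1 < sqrt (1 + 8n)]; squaring yields
    [m (m - 1) / 2 <= n], which rearranges to the claim. Squaring needs [0 <= 2m - 1], hence the
    separate case [m = 0]. *)
Lemma g_le_f (n : nat) : (g R n <= f R n)%N.
Proof.
have [f0|f_gt0] := posnP (f R n).
  by have := g_addn n; rewrite f0 bin2 /=; lia.
rewrite -(ler_nat R) gE.
have := ceilB1_lt ((-1 + Num.sqrt (1 + 8 * n%:R)) / 2 : R).
rewrite -fE intrB -pmulrn.
have s0 := sqrtr_ge0 (1 + 8 * n%:R : R).
have f1 : 1 <= (f R n)%:R :> R by rewrite ler1n.
have : Num.sqrt (1 + 8 * n%:R : R) ^+ 2 = 1 + 8 * n%:R by rewrite sqr_sqrtr.
set s := Num.sqrt _ in s0 *; set m : R := (f R n)%:R in f1 * => s2 ms.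
have : (2 * m - 1) ^+ 2 <= s ^+ 2 by rewrite lerXn2r// ?nnegrE; lra.
by rewrite s2 expr2; lra.
Qed.

Lemma vol_II_setD (n : nat) (B : set nat) : vol R B = (g R n)%:R%:E ->
  vol R (`I_(f R n).+1 `\` B) = n%:R%:E.
Proof.
move=> volB; have BI : B `<=` `I_(f R n).+1.
  by apply: (@vol_subset_II R); rewrite volB lee_fin ler_nat g_le_f.
have := vol_setD R BI; rewrite vol_II -g_addn volB natrD EFinD.
(* Cancelling in the extended reals is legitimate because the equation rules out infinite values. *)
by case: (vol R _) => [r [/addrI->]||].
Qed.

End TriangularRoot.

Section Extremal.
Variable R : realType.

Lemma P_witness (n : nat) :
  exists A : set nat, vol R A = n%:R%:E /\ per R A = (P R n)%:R%:E.
Proof. by rewrite /P; case: ex_minnP => k /asboolP. Qed.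

Lemma Q_witness (n : nat) :
  exists A : set nat, vol R A = n%:R%:E /\ per R (~` A) = (Q R n)%:R%:E.
Proof. by rewrite /Q; case: ex_minnP => k /asboolP. Qed.

Lemma vol_finite_set (n : nat) (A : set nat) :
  vol R A = n%:R%:E -> finite_set A.
Proof.
move=> vA; apply: sub_finite_set (finite_II n.+1).
by apply: (@vol_subset_II R); rewrite vA.
Qed.

(** Minimality in [P] speaks only of natural perimeters, so [A] is first shown finite; this lets the
    bound be checked in the extended reals. *)
Lemma P_le (n k : nat) (A : set nat) :
  vol R A = n%:R%:E -> (per R A <= k%:R%:E)%E -> (P R n <= k)%N.
Proof.
move=> vA; have [|j perE] := @finite_vol R (boundary A).
  by apply: sub_finite_set (@vol_finite_set _ _ vA) => z [].
rewrite {1}/per perE lee_fin ler_nat; apply: leq_trans.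
by rewrite /P; case: ex_minnP => l _; apply; apply/asboolP; exists A.
Qed.

Lemma Q_le (n k : nat) (A : set nat) :
  vol R A = n%:R%:E -> (per R (~` A) <= k%:R%:E)%E -> (Q R n <= k)%N.
Proof.
move=> vA; have [|j perE] := @finite_vol R (boundary (~` A)).
  exact: boundary_setC_finite (@vol_finite_set _ _ vA).
rewrite {1}/per perE lee_fin ler_nat; apply: leq_trans.
by rewrite /Q; case: ex_minnP => l _; apply; apply/asboolP; exists A.
Qed.

End Extremal.

Theorem theorem10 (R : realType) (n : nat) :
  (P R n <= f R n + Q R (g R n))%N /\ (Q R n <= 1 + f R n + P R (g R n))%N.
Proof.
split.
- have [B [volB perB]] := Q_witness R (g R n).
  apply: P_le (vol_II_setD volB) _.
  rewrite natrD EFinD -perB.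
  exact: le_trans (le_vol _ (@boundary_II_setD _ _)) (vol_setU1 _ _ _).
- have [B [volB perB]] := P_witness R (g R n).
  apply: Q_le (vol_II_setD volB) _.
  rewrite natrD EFinD -perB.
  (* The extra boundary point [(f R n).+1] accounts for the term [1 + f R n]. *)
  exact: le_trans (le_vol _ (@boundary_setC_II_setD _ _)) (vol_setU1 _ _ _).
Qed.
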